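(* For every decreasing function $\eta:\mathbf{N}\to(0,1)$ there is some $M=M(\eta)\in\mathbf{N}$ such that the following holds. Every finite group $G$ has a normal subgroup $H$ such that (1) $|[H,H]|\leq M$, and (2) with at most $\eta(|[H,H]|)\,|G|^2$ exceptions, every pair $(x,y)\in G^2$ such that $[x,y]\in[H,H]$ is contained in $H^2$; that is, $|\{(x,y)\in G^2\setminus H^2: [x,y]\in[H,H]\}|\leq\eta(|[H,H]|)\,|G|^2$.
   Context: For elements $x,y$ of a group, $[x,y]=x^{-1}y^{-1}xy$. For subgroups $H,K\leq G$, $[H,K]$ denotes the subgroup generated by all commutators $[h,k]$ with $h\in H$, $k\in K$; so $[H,H]$ is the commutator subgroup of $H$. $H^2=H\times H\subset G^2=G\times G$. $\mathbf{N}$ is the set of natural numbers. The integer $M$ depends only on $\eta$. *)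

(* Defs.v *)
From mathcomp Require Export all_boot all_order all_fingroup all_algebra.
From mathcomp Require Export reals.

Set Implicit Arguments.
Unset Strict Implicit.
Unset Printing Implicit Defensive.

Import GroupScope.

(* [~ x, y] is x^-1 * x ^ y, that is x^-1 * y^-1 * x * y. *)
Definition exceptional_pairs (gT : finGroupType) (G H : {group gT}) :
    {set gT * gT} :=
  [set xy in setX G G :\: setX H H | [~ xy.1, xy.2] \in [~: H, H]].

(* Main.v *)
(* Let [X] be the set of elements whose class modulo [[~: H, H]] has size at most
   [T].  If [X] has density at least [1 / T], then every element of [<<X>>] is a
   product of boundedly many elements of [X], so its class has bounded size, and
   B. H. Neumann's theorem on groups with bounded classes bounds the derived
   subgroup of [<<X>>] modulo [[~: H, H]].  Start with [H = 1].  If [H] has too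
   many exceptional pairs, then for large [T] the set [X] is dense and not
   contained in [H]; replace [H] by the preimage of [<<X>>].  The first such [H]
   has index at most [T], and from then on [H] is contained in [X] once [T]
   exceeds its index, so that the index strictly decreases. *)
Require Import Defs.
From mathcomp Require Import commutator zify.
Import GroupScope.

Set Implicit Arguments.
Unset Strict Implicit.
Unset Printing Implicit Defensive.

(** * Product sets and their powers *)

Lemma card_mulg_leq (gT : finGroupType) (A B : {set gT}) :
  #|A * B| <= #|A| * #|B|.
Proof. by rewrite [A * B]curry_imset2X -cardsX leq_imset_card. Qed.

Lemma card_expg_leq (gT : finGroupType) (A : {set gT}) n :
  #|A ^+ n| <= #|A| ^ n.
Proof.
elim: n => [|n IHn]; first by rewrite expg0 cards1.
by rewrite !expgS expnS (leq_trans (card_mulg_leq _ _)) // leq_mul2l IHn orbT.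
Qed.

Lemma leq_card_bigcup (I T : finType) (A : {pred I}) (F : I -> {set T}) b :
  (forall i, i \in A -> #|F i| <= b) -> #|\bigcup_(i in A) F i| <= #|A| * b.
Proof.
move=> leFb; rewrite -sum_nat_const.
apply: leq_trans (leq_sum _ leFb).
elim/big_rec2: _ => [|i m B _ leBm]; first by rewrite cards0.
by rewrite (leq_trans (leq_card_setU _ _)) ?leq_add2l.
Qed.

Lemma mem_expgX (gT : finGroupType) (A : {set gT}) x n :
  x \in A -> x ^+ n \in A ^+ n.
Proof.
move=> Ax; elim: n => [|n IHn]; first by rewrite !expg0 inE.
by rewrite !(expgS _ n) mem_mulg.
Qed.

Lemma mem_expg_prod (gT : finGroupType) (A : {set gT}) (s : seq gT) :
  {subset s <= A} -> \prod_(x <- s) x \in A ^+ size s.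
Proof.
elim: s => [|x s IHs] sA; first by rewrite big_nil expg0 inE.
rewrite big_cons /= expgS mem_mulg ?sA ?mem_head // IHs // => y sy.
by rewrite sA // inE sy orbT.
Qed.

Lemma expg_prodP (gT : finGroupType) (A : {set gT}) n x :
  x \in A ^+ n ->
  exists s : seq gT, [/\ {subset s <= A}, size s = n & x = \prod_(y <- s) y].
Proof.
elim: n x => [|n IHn] x.
  by rewrite expg0 inE => /eqP->; exists [::]; rewrite big_nil.
rewrite expgS => /mulsgP[a b Aa /IHn[s [sA <- ->]] ->].
exists (a :: s); rewrite big_cons; split=> // y.
by rewrite inE => /predU1P[-> | /sA].
Qed.

Lemma expg_subset (gT : finGroupType) (A : {set gT}) m n :
  1 \in A -> m <= n -> A ^+ m \subset A ^+ n.
Proof.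
move=> A1 /subnKC <-; elim: (n - m) => [|k IHk]; first by rewrite addn0.
by rewrite addnS expgSr (subset_trans IHk) // mulg_subl.
Qed.

(** Such a power absorbs multiplication by [A], hence contains every power of [A], and in a finite
    group [<<A>>] is one of these. *)
Lemma gen_sub_expg (gT : finGroupType) (A : {set gT}) k :
  1 \in A -> A ^+ k.+1 \subset A ^+ k -> <<A>> \subset A ^+ k.
Proof.
move=> A1 sAk; have [n ->] := gen_expgs A.
rewrite (setUidPr _) ?sub1set //; elim: n => [|n IHn].
  by rewrite expg_subset.
by rewrite expgSr (subset_trans (mulSg _ IHn)) // -expgSr.
Qed.

Lemma expg_sub_gen (gT : finGroupType) (A : {set gT}) k :
  A ^+ k \subset <<A>>.
Proof.
elim: k => [|k IHk]; first by rewrite expg0 sub1set group1.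
by rewrite expgS mul_subG ?subset_gen.
Qed.

(* If [z] lies in [A ^+ m.+2] but not in [A ^+ m.+1], then [z *: A] is disjoint
   from [A ^+ m], so the powers of [A] grow linearly until they stabilise. *)
Lemma gen_sub_expg_large (gT : finGroupType) (A : {set gT}) T :
  1 \in A -> A^-1 = A -> #|<<A>>| <= T * #|A| -> <<A>> \subset A ^+ (3 * T).+1.
Proof.
move=> A1 AV leT.
have grow j : <<A>> \subset A ^+ (3 * j).+1 \/ j.+1 * #|A| <= #|A ^+ (3 * j).+1|.
  elim: j => [|j IHj]; first by right; rewrite mul1n.
  have ->: (3 * j.+1).+1 = (3 * j).+1.+3 by lia.
  have sub i : i <= (3 * j).+1.+3 -> A ^+ i \subset A ^+ (3 * j).+1.+3.
    by move=> ?; apply: expg_subset.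
  case: IHj => [sG | IHj]; first by left; rewrite (subset_trans sG) ?sub //; lia.
  move: (3 * j).+1 IHj sub => m IHj sub.
  have [/(gen_sub_expg A1) sG | /subsetPn[z Az nAz]] :=
    boolP (A ^+ m.+2 \subset A ^+ m.+1).
    by left; rewrite (subset_trans sG) ?sub //; lia.
  right; rewrite mulSn addnC.
  have dis : [disjoint A ^+ m & z *: A].
    rewrite -setI_eq0; apply/eqP/setP=> y; rewrite !inE.
    apply/negP=> /andP[Ay /lcosetP[a Aa def_y]].
    case/negP: nAz; rewrite -(mulgK a z) -def_y expgSr mem_mulg //.
    by rewrite -AV mem_invg invgK.
  apply: leq_trans (_ : #|A ^+ m :|: z *: A| <= _).
    by rewrite cardsU disjoint_setI0 // cards0 subn0 card_lcoset leq_add2r.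
  apply: subset_leq_card; rewrite subUset sub //=; last by lia.
  by rewrite (expgSr A m.+2) mulSg ?sub1set.
(* The other alternative at [j = T] would give [T.+1 * #|A| <= #|<<A>>| <= T * #|A|], impossible
   since [A] is not empty. *)
have [//|] := grow T.
have /subset_leq_card := expg_sub_gen A (3 * T).+1.
have: 0 < #|A| by apply/card_gt0P; exists 1.
by move: leT; nia.
Qed.

(** * B. H. Neumann's theorem on groups with bounded classes *)

Section ConjugateBound.
Variables (gT : finGroupType) (G : {group gT}) (n : nat).

Lemma card_class_prod (x y : gT) : #|(x * y) ^: G| <= #|x ^: G| * #|y ^: G|.
Proof.
apply: leq_trans (card_mulg_leq _ _); apply: subset_leq_card.
by apply/subsetP=> _ /imsetP[g Gg ->]; rewrite conjMg mem_mulg ?imset_f.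
Qed.

Lemma card_class_expg (A : {set gT}) k x :
    (forall a, a \in A -> #|a ^: G| <= n) -> x \in A ^+ k -> #|x ^: G| <= n ^ k.
Proof.
move=> leA; elim: k x => [|k IHk] x.
  by rewrite expg0 inE => /eqP->; rewrite class1G cards1.
rewrite expgS => /mulsgP[a b Aa /IHk leb ->].
by rewrite expnS (leq_trans (card_class_prod _ _)) // leq_mul ?leA.
Qed.

Hypothesis leGn : forall x, x \in G -> #|x ^: G| <= n.

(** Centralising one more element [x] cuts a subgroup [U] of [G] down by the index [#|x ^: U|], at
    most [#|x ^: G| <= n]. *)
Lemma index_cent_seq (s : seq gT) :
  {subset s <= G} -> #|G : 'C_G([set x in s])| <= n ^ size s.
Proof.
elim: s => [|x s IHs] sG.
  rewrite (setIidPl _) ?indexgg //.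
  by apply/centsP=> x _ y; rewrite inE.
have Gx : x \in G by rewrite sG ?mem_head.
have {}IHs : #|G : 'C_G([set y in s])| <= n ^ size s.
  by apply: IHs => y sy; rewrite sG // inE sy orbT.
rewrite set_cons centU cent_set1 setICA.
set U := 'C_G([set y in s]) in IHs *.
rewrite setIC -(@Lagrange_index _ G U) ?subsetIl //= expnSr leq_mul //.
rewrite index_cent1 (leq_trans _ (leGn Gx)) // subset_leq_card //.
by rewrite imsetS ?subsetIl.
Qed.

(* B. H. Neumann's trick: let [a] have the largest class and let [U] centralise
   elements conjugating [a] to all of [a ^: G]; then the class of [u * a], for
   [u] in [U], is [u *: (a ^: G)]. *)
Lemma card_commg_set : #|commg_set G G| <= n ^ n * n ^ 3.
Proof.
pose a := [arg max_(x > 1 in G) #|x ^: G|].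
have [Ga maxa] : a \in G /\ forall x, x \in G -> #|x ^: G| <= #|a ^: G|.
  by rewrite /a; case: arg_maxnP => [|x Gx max_x]; rewrite ?group1.
set A := a ^: G.
pose b c := odflt 1 [pick g in G | c == a ^ g].
have bP c : c \in A -> b c \in G /\ a ^ b c = c.
  case/imsetP=> g Gg def_c; rewrite /b; case: pickP => [h /andP[Gh /eqP->] //|].
  by move/(_ g); rewrite Gg def_c eqxx.
pose s := [seq b c | c <- enum A].
have sG : {subset s <= G}.
  by move=> x /mapP[c]; rewrite mem_enum => /bP[Gc _] ->.
pose U := 'C_G([set x in s])%G.
have leU : #|G : U| <= n ^ n.
  have n_gt0 : 0 < n by rewrite (leq_trans _ (leGn Ga)) // -index_cent1.
  rewrite (leq_trans (index_cent_seq sG)) // leq_pexp2l // size_map -cardE.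
  exact: leGn.
have commU u y : u \in U -> y \in G -> [~ u, y] \in A * A^-1.
  move=> Uu Gy; have [Gu Cu] := setIP Uu.
  have uA : u *: A = (u * a) ^: G.
    apply/eqP; rewrite eqEcard card_lcoset maxa ?groupM // andbT.
    apply/subsetP=> _ /lcosetP[c Ac ->]; have [Gb def_c] := bP c Ac.
    apply/imsetP; exists (b c) => //; rewrite conjMg def_c; congr (_ * _).
    apply/esym/conjg_fixP/commgP/(centP Cu).
    by rewrite inE map_f // mem_enum.
  have : (u * a) ^ y \in u *: A by rewrite uA imset_f.
  case/lcosetP=> c Ac; rewrite conjMg => def_c.
  (* From [u ^ y * a ^ y = u * c] follows [[~ u, y] = c * (a ^ y)^-1]. *)
  rewrite commgEl -(mulgK (a ^ y) (u ^ y)) def_c -mulgA mulKg.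
  by rewrite mem_mulg // mem_invg invgK imset_f.
have conjA z g : g \in G -> z \in A * A^-1 -> z ^ g \in A * A^-1.
  move=> Gg /mulsgP[c d Ac Ad ->]; rewrite conjMg mem_mulg ?memJ_class //.
    by move: Ac => /imsetP[h Gh ->]; rewrite -conjgM imset_f ?groupM.
  move: Ad; rewrite !mem_invg -conjVg => /imsetP[h Gh ->].
  by rewrite -conjgM imset_f ?groupM.
(* If [x = u * t] with [u] in [U] and [t] the representative of [U :* x], then [[~ x, y] = [~ u, y]
   ^ t * [~ t, y]]. The first factor lies in [A * A^-1], the second in [t^-1 *: t ^: G], whence at
   most [n ^ 3] values per coset. *)
pose F (C : {set gT}) := A * A^-1 * ((repr C)^-1 *: (repr C) ^: G).
have leA : #|A| <= n by apply: leGn.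
have sF : commg_set G G \subset \bigcup_(C in rcosets U G) F C.
  apply/subsetP=> _ /imset2P[x y Gx Gy ->]; apply/bigcupP.
  exists (U :* x); first by apply/rcosetsP; exists x.
  rewrite /F; set t := repr _.
  have Ut : t \in U :* x by apply: mem_repr_rcoset.
  have Gt : t \in G.
    by apply: subsetP Ut; rewrite mul_subG ?subsetIl ?sub1set.
  have : x \in U :* t by rewrite (rcoset_eqP Ut) rcoset_refl.
  case/rcosetP=> u Uu ->; rewrite commMgJ mem_mulg //.
    by rewrite conjA ?commU.
  by rewrite commgEl mem_lcoset invgK mulKVg imset_f.
rewrite (leq_trans (subset_leq_card sF)) //.
rewrite (leq_trans (@leq_card_bigcup _ _ _ _ (n ^ 3) _)) //; last first.
  by rewrite leq_mul2r leU orbT.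
move=> _ /rcosetsP[x Gx ->]; rewrite /F; set t := repr _.
have Ut : t \in U :* x by apply: mem_repr_rcoset.
have Gt : t \in G.
  by apply: subsetP Ut; rewrite mul_subG ?subsetIl ?sub1set.
rewrite (leq_trans (card_mulg_leq _ _)) // expnSr leq_mul //.
  by rewrite (leq_trans (card_mulg_leq _ _)) // card_invg leq_mul.
by rewrite card_lcoset leGn.
Qed.

Lemma conjg_commg_set c g : g \in G -> c \in commg_set G G ->
  c ^ g \in commg_set G G.
Proof.
move=> Gg /imset2P[x y Gx Gy ->].
by rewrite conjRg; apply/imset2P; exists (x ^ g) (y ^ g); rewrite ?groupJ.
Qed.

(** Pigeonhole: the conjugates of [y] by [c ^+ 0], ..., [c ^+ n] lie in a class of size at most [n],
    so two of them agree; [k] is the difference of their exponents. *)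
Lemma expg_centralises (c y : gT) : c \in G -> y \in G ->
  exists2 k, 0 < k <= n & commute y (c ^+ k).
Proof.
move=> Gc Gy; pose f (i : 'I_n.+1) := y ^ (c ^+ i).
have /injectivePn[i [j ij fij]] : ~~ injectiveb f.
  apply/injectiveP=> /(card_imset [set: 'I_n.+1]).
  apply/eqP; rewrite neq_ltn cardsT card_ord ltnS.
  apply/orP; left; apply: leq_trans (leGn Gy); apply: subset_leq_card.
  by apply/subsetP=> _ /imsetP[k _ ->]; rewrite /f imset_f ?groupX.
wlog lt_ij : i j ij fij / i < j.
  move=> IH; case: (ltngtP i j) => [/IH|/IH|/val_inj/eqP]; first exact.
    by apply; rewrite // eq_sym.
  by rewrite (negPf ij).
exists (j - i); first by have := ltn_ord j; lia.
apply/commgP/conjg_fixP; apply: (conjg_inj (c ^+ i)).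
by rewrite -conjgM -expgD subnK ?fij // ltnW.
Qed.

(* Rosenlicht's trick, resting on [c * c ^ y = [~ x, y ^+ 2]] for
   [c = [~ x, y]]. *)
Lemma expg_commg_shorten c : c \in commg_set G G ->
  exists2 k, k < n & c ^+ k.+2 \in commg_set G G ^+ k.+1.
Proof.
case/imset2P=> x y Gx Gy def_c.
have Cc : c \in commg_set G G by rewrite def_c imset2_f.
have Gc : c \in G by rewrite def_c groupR.
have [[|k] // lekn cyk] := expg_centralises Gc Gy.
exists k => //.
(* As [y] commutes with [c ^+ k.+1], that power equals [(c ^ y) ^+ k.+1]; one factor [c ^ y] of it
   joins the remaining [c]. *)
have -> : c ^+ k.+2 = [~ x, y ^+ 2] * (c ^ y) ^+ k.
  have -> : [~ x, y ^+ 2] = c * c ^ y.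
    by rewrite def_c /commg /conjg expgS expg1 !invMg !mulgA !(mulgKV, mulgK).
  rewrite -mulgA -expgS -conjXg [in LHS]expgS; congr (_ * _).
  by apply/esym/conjg_fixP/commgP/commute_sym.
rewrite (expgS _ k) mem_mulg ?imset2_f ?groupX ?mem_expgX //.
exact: conjg_commg_set.
Qed.

(** Pulling copies of [c] to the left conjugates the factors they pass by powers of [c]; conjugates
    of commutators are commutators, so no factor is gained. *)
Lemma prod_move_front (s : seq gT) c :
    {subset s <= commg_set G G} -> c \in commg_set G G ->
  exists t : seq gT, [/\ {subset t <= commg_set G G},
    (size t + count_mem c s)%N = size s &
    \prod_(x <- s) x = c ^+ count_mem c s * \prod_(x <- t) x].
Proof.
move=> + Cc; have Gc : c \in G.
  by case/imset2P: Cc => x y Gx Gy ->; rewrite groupR.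
elim: s => [|x s IHs] sC; first by exists [::]; rewrite !big_nil mulg1.
have Cx : x \in commg_set G G by rewrite sC ?mem_head.
have [y sy|t [tC szt prt]] := IHs; first by rewrite sC // inE sy orbT.
rewrite big_cons prt /=; have [->|_] := eqVneq x c.
  by exists t; rewrite addnS szt add1n expgS mulgA.
exists (x ^ (c ^+ count_mem c s) :: t); split=> /=; last 1 first.
- by rewrite big_cons add0n mulgA (conjgC x) -mulgA.
- move=> y; rewrite inE => /predU1P[->|/tC//].
  by rewrite conjg_commg_set ?groupX.
by rewrite addSn szt.
Qed.

Lemma size_le_count (s : seq gT) (A : {set gT}) k :
    {subset s <= A} -> (forall c, c \in A -> count_mem c s <= k) ->
  size s <= #|A| * k.
Proof.
move=> sA leA; rewrite -sum_nat_const; apply: leq_trans (leq_sum _ leA).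
elim: s sA {leA} => [//|x s IHs] sA; rewrite /= big_split /=.
rewrite (bigD1 x) ?sA ?mem_head //= eqxx.
rewrite -add1n -addnA leq_add //; apply: leq_trans (leq_addl _ _).
by apply: IHs => y sy; rewrite sA // inE sy orbT.
Qed.

(** A product of [N.+1] commutators repeats some [c] more than [n] times. Once [k.+2] copies of [c]
    are gathered in front, they can be rewritten as [k.+1] commutators. So [C ^+ N.+1] lies in
    [C ^+ N], and the powers of [C] have stabilised. *)
Lemma card_der_classes : #|[~: G, G]| <= (n ^ n * n ^ 3) ^ (n ^ n * n ^ 3 * n).
Proof.
set C := commg_set G G; pose N := (n ^ n * n ^ 3 * n)%N.
have C1 : 1 \in C by apply/imset2P; exists 1 1; rewrite ?commg1.
have leC : #|C| <= n ^ n * n ^ 3 by apply: card_commg_set.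
have : [~: G, G] \subset C ^+ N.
  apply: gen_sub_expg => //; apply/subsetP=> _ /expg_prodP[s [sC szs ->]].
  have [c Cc ltc] : exists2 c, c \in C & n < count_mem c s.
    apply/exists_inP; apply: contraLR (ltnSn N) => /exists_inPn lec.
    rewrite -leqNgt -szs.
    rewrite (leq_trans (@size_le_count s C n sC _)) ?leq_mul2r ?leC ?orbT //.
    by move=> c /lec; rewrite -leqNgt.
  have [k ltkn Ck] := expg_commg_shorten Cc.
  have [t [tC szt ->]] := prod_move_front sC Cc.
  have -> : count_mem c s = k.+2 + (count_mem c s - k.+2) by lia.
  rewrite expgD -mulgA.
  have -> : N = k.+1 + (count_mem c s - k.+2 + size t) by lia.
  rewrite !expgD mem_mulg // mem_mulg ?mem_expgX ?mem_expg_prod //.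
move/subset_leq_card/leq_trans; apply.
apply: leq_trans (card_expg_leq _ _) _.
by rewrite -/N; case: (N) => [|k]; rewrite ?expn0 // leq_exp2r.
Qed.

End ConjugateBound.

(** * The subgroup generated by a dense set of small classes *)

Definition der_bound (T : nat) : nat :=
  let n := (T ^ (3 * T).+1)%N in ((n ^ n * n ^ 3) ^ (n ^ n * n ^ 3 * n))%N.

(** Elements of [<<X>>] are products of [(3 * T).+1] elements of [X], so their classes have size at
    most [T ^ (3 * T).+1], the [n] of [der_bound]; then Neumann's bound applies. *)
Lemma card_der_gen_small_classes (gT : finGroupType) (G : {group gT}) T
    (X := [set x in G | #|x ^: G| <= T]) :
  #|G| <= T * #|X| -> #|[~: <<X>>, <<X>>]| <= der_bound T.
Proof.
move=> leG; have sXG : X \subset G by apply/subsetP=> x; rewrite inE => /andP[].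
have T_gt0 : 0 < T by rewrite lt0n; apply: contraTneq leG => ->; rewrite mul0n -ltnNge.
have X1 : 1 \in X by rewrite inE group1 class1G cards1.
have XV : X^-1 = X.
  by apply/setP=> x; rewrite mem_invg !inE groupV classVg card_invg.
have sYG : <<X>> \subset G by rewrite gen_subG.
have sYX : <<X>> \subset X ^+ (3 * T).+1.
  by apply: gen_sub_expg_large; rewrite // (leq_trans (subset_leq_card sYG)).
apply: card_der_classes => x /(subsetP sYX) Xx.
apply: leq_trans (subset_leq_card (imsetS _ sYG)) _.
by apply: card_class_expg Xx => a; rewrite inE => /andP[].
Qed.

(** * Elements with small class modulo a normal subgroup *)

Definition centraliser_mod (gT : finGroupType) (G K : {group gT}) x :=
  [set y in G | [~ x, y] \in K].

(** For [K] normal in [G], this says that the class of [coset K x] in [G / K] has size at most [T],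
    by [card_class_quotient]. *)
Definition nearly_central_mod (gT : finGroupType) (G K : {group gT}) T :=
  [set x in G | #|G| <= T * #|centraliser_mod G K x|].

Section ModNormal.
Variables (gT : finGroupType) (G K : {group gT}) (T : nat).
Hypothesis nsKG : K <| G.
Let nKG : G \subset 'N(K) := normal_norm nsKG.
Let sKG : K \subset G := normal_sub nsKG.

Local Notation X := (nearly_central_mod G K T).

(** Orbit-stabiliser in [G / K], multiplied by [#|K|]: [centraliser_mod G K x] is the preimage of
    the centraliser of [coset K x]. *)
Lemma card_class_quotient x : x \in G ->
  (#|centraliser_mod G K x| * #|coset K x ^: (G / K)| = #|G|)%N.
Proof.
move=> Gx; have Nx := subsetP nKG x Gx.
pose C := 'C_(G / K)[coset K x].
have -> : centraliser_mod G K x = coset K @*^-1 C.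
  apply/setP=> y; rewrite inE; have [Gy|nGy] /= := boolP (y \in G); last first.
    apply/esym/negbTE; apply: contra nGy.
    rewrite -[in X in _ -> X](quotientGK nsKG).
    by apply: subsetP y; rewrite morphpreS ?subsetIl.
  have Ny := subsetP nKG y Gy.
  have -> : (y \in coset K @*^-1 C) = (coset K y \in C) by apply/morphpreP/idP => [[]|].
  rewrite in_setI mem_quotient //=.
  rewrite -[in RHS]cent1C; apply/idP/cent1P => [Kxy|/commgP].
    by apply/commgP; rewrite -morphR //= coset_id.
  by rewrite -morphR //= => /eqP/coset_idr->; rewrite ?groupR.
rewrite card_cosetpre -index_cent1 -mulnA Lagrange ?subsetIl //.
by rewrite card_quotient ?Lagrange.
Qed.

Lemma normal_nearly_central_mod : #|G| <= T * #|X| ->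
  exists H : {group gT},
    [/\ H <| G, X \subset H & #|[~: H, H]| <= #|K| * der_bound T].
Proof.
move=> leG; pose Y := [set z in G / K | #|z ^: (G / K)| <= T].
have mapX x : x \in X -> coset K x \in Y.
  rewrite !inE => /andP[Gx]; rewrite mem_quotient //=.
  rewrite -{1}(card_class_quotient Gx) mulnC leq_pmul2r //.
  by apply/card_gt0P; exists 1; rewrite inE group1 commg1 group1.
have leQ : #|G / K| <= T * #|Y|.
  rewrite -(leq_pmul2l (cardG_gt0 K)) card_quotient // Lagrange //.
  rewrite mulnCA (mulnC #|K|) (leq_trans leG) // leq_mul2l; apply/orP; right.
  (* [X] is covered by the cosets belonging to [Y], each of size [#|K|], so the density of [X]
     passes to [Y]. *)
  apply: leq_trans (_ : #|\bigcup_(z in Y) (z : {set gT})| <= _); last first.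
    apply: leq_card_bigcup => z; rewrite inE => /andP[/morphimP[x Nx _ ->] _].
    by rewrite val_coset ?card_rcoset.
  apply/subset_leq_card/subsetP=> x Xx; apply/bigcupP; exists (coset K x).
    exact: mapX.
  rewrite val_coset ?rcoset_refl // (subsetP nKG) //.
  by move: Xx; rewrite inE => /andP[].
have nsYQ : <<Y>> <| G / K.
  rewrite /normal gen_subG; apply/andP; split.
    by apply/subsetP=> z; rewrite inE => /andP[].
  apply: norms_gen; apply/normsP=> q Qq; apply/setP=> z.
  by rewrite mem_conjg !inE groupJr ?groupV // classGidl ?groupV.
have [H defY sKH nsHG] := inv_quotientN nsKG nsYQ.
have nKH : H \subset 'N(K) := subset_trans (normal_sub nsHG) nKG.
exists H; split=> //.
  apply/subsetP=> x Xx.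
  rewrite -(quotientGK (normalS sKH (normal_sub nsHG) nsKG)).
  have Gx : x \in G by move: Xx; rewrite inE => /andP[].
  by apply/morphpreP; rewrite /= -defY mem_gen ?mapX ?(subsetP nKG).
have nKR : [~: H, H] \subset 'N(K).
  by rewrite (subset_trans _ nKH) // commg_subl normG.
(* The part of [[~: H, H]] inside [K] costs [#|K|]; its image in [G / K] is the derived subgroup of
   [<<Y>>]. *)
rewrite -(LagrangeI [~: H, H]%G K) leq_mul ?subset_leq_card ?subsetIr //.
rewrite -card_quotient // quotientR // -defY.
exact: card_der_gen_small_classes.
Qed.

(** Each [x] outside [X] has at most [#|G| %/ T] partners [y], and there are at most [#|G|] such
    [x]. *)
Lemma card_not_nearly_central_pairs :
  T * #|[set xy in setX (G :\: X) G | [~ xy.1, xy.2] \in K]| <= #|G| ^ 2.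
Proof.
have [->|T_gt0] := posnP T; first by rewrite mul0n.
rewrite mulnC -leq_divRL //.
pose F x := pair x @: centraliser_mod G K x.
apply: leq_trans (_ : #|\bigcup_(x in G :\: X) F x| <= _).
  apply/subset_leq_card/subsetP=> -[x y].
  rewrite !inE /= => /andP[/andP[Bx Gy] Kxy].
  by apply/bigcupP; exists x; rewrite ?inE // imset_f ?inE ?Gy.
apply: leq_trans (_ : #|G| * (#|G| %/ T) <= _); last first.
  by rewrite -mulnn mulnC leq_divRL // mulnAC leq_mul // leq_divM.
apply: leq_trans (leq_card_bigcup (b := #|G| %/ T) _) _; last first.
  by rewrite leq_mul2r subset_leq_card ?orbT ?subsetDl.
move=> x; rewrite !inE => /andP[+ Gx]; rewrite Gx -ltnNge => /ltnW leT.
by rewrite (leq_trans (leq_imset_card _ _)) // leq_divRL // mulnC.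
Qed.

End ModNormal.

(** * Counting exceptional pairs *)

Lemma card_exceptional_pairs (gT : finGroupType) (G H : {group gT}) T :
    H <| G -> nearly_central_mod G [~: H, H]%G T \subset H ->
  T * #|exceptional_pairs G H| <= 2 * #|G| ^ 2.
Proof.
move=> nsHG sXH; set X := nearly_central_mod _ _ _ in sXH.
set E := exceptional_pairs G H.
pose D := [set xy in setX (G :\: X) G | [~ xy.1, xy.2] \in [~: H, H]].
pose swap (xy : gT * gT) := (xy.2, xy.1).
have leD : T * #|D| <= #|G| ^ 2 by apply: card_not_nearly_central_pairs.
(* One coordinate of an exceptional pair is outside [H], hence outside [X]. Since [[~ y, x]] is the
   inverse of [[~ x, y]], swapping makes it the first one; this gives the factor 2. *)
have sE : E \subset D :|: swap @: D.
  apply/subsetP=> -[x y]; rewrite !inE /= => /andP[/andP[nH /andP[Gx Gy]] Kxy].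
  move: nH; rewrite negb_and => /orP[nHx|nHy]; apply/orP; [left|right].
    rewrite Gx Gy Kxy !andbT /=; apply: contra nHx => Xx.
    by rewrite (subsetP sXH) ?inE ?Gx.
  apply/imsetP; exists (y, x) => //.
  rewrite !inE Gx Gy /= -invg_comm groupV Kxy !andbT.
  by apply: contra nHy => Xy; rewrite (subsetP sXH) ?inE ?Gy.
apply: leq_trans (_ : T * (#|D| + #|D|) <= _); last by lia.
rewrite leq_mul2l; apply/orP; right; apply: leq_trans (subset_leq_card sE) _.
by rewrite (leq_trans (leq_card_setU _ _)) // leq_add2l leq_imset_card.
Qed.

(** Pairs with first coordinate outside [X] number at most [#|G| ^ 2 / T], and so do those with
    first coordinate in [X], because [X] itself is sparse. *)
Lemma card_commuting_pairs (gT : finGroupType) (G : {group gT}) T :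
    T * #|nearly_central_mod G 1%G T| < #|G| ->
  T * #|exceptional_pairs G 1%G| <= 2 * #|G| ^ 2.
Proof.
set X := nearly_central_mod _ _ _ => ltX.
pose D := [set xy in setX (G :\: X) G | [~ xy.1, xy.2] \in 1%G].
have leD : T * #|D| <= #|G| ^ 2.
  exact: card_not_nearly_central_pairs.
have sE : exceptional_pairs G 1%G \subset D :|: setX X G.
  apply/subsetP=> -[x y]; rewrite in_setU /D !in_set /= commG1.
  case/andP=> /andP[_ /andP[-> ->]] ->; rewrite !andbT /=.
  by rewrite orNb.
apply: leq_trans (_ : T * (#|D| + #|X| * #|G|) <= _).
  rewrite leq_mul2l; apply/orP; right; apply: leq_trans (subset_leq_card sE) _.
  by rewrite -cardsX leq_card_setU.
rewrite mulnDr mulnA mul2n -addnn leq_add // -mulnn leq_mul2r.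
by rewrite (ltnW ltX) orbT.
Qed.

(** * Induction on the index *)

Import Order.TTheory GRing.Theory Num.Theory.
Local Open Scope ring_scope.

Lemma exists_threshold (R : realType) (e : R) : 0 < e ->
  exists T : nat, forall a b : nat,
    (T * a <= 2 * b ^ 2)%N -> a%:R <= e * b%:R ^+ 2.
Proof.
move=> e_gt0; exists (Num.bound (2 / e)) => a b.
set T := Num.bound _; rewrite -(ler_nat R) (natrM _ T) (natrM _ 2) natrX => leab.
have ltT : 2 / e < T%:R by apply: archi_boundP; rewrite divr_ge0 // ltW.
rewrite -(ler_pM2l (x := 2 / e)) ?divr_gt0 // mulrA divfK ?gt_eqF //.
by rewrite (le_trans _ leab) // ler_wpM2r // ltW.
Qed.

Section Main.
Variables (R : realType) (eta : nat -> R).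
Hypothesis eta_decr : forall m n : nat, (m <= n)%N -> eta n <= eta m.
Hypothesis eta_01 : forall n : nat, 0 < eta n < 1.

Definition few_exceptions (gT : finGroupType) (G H : {group gT}) :=
  #|exceptional_pairs G H|%:R <= eta #|[~: H, H]%g| * #|G|%:R ^+ 2.

(** Induction on [k]. Each threshold depends only on [k], [m] and [eta], so [M] is uniform in the
    group; [m] becomes [m * der_bound T] when the index drops. *)
Lemma few_exceptions_bounded_index k m : exists M : nat,
  forall (gT : finGroupType) (G H0 : {group gT}),
    (H0 <| G)%g -> (#|G : H0| <= k)%N -> (#|[~: H0, H0]%g| <= m)%N ->
  exists H : {group gT},
    [/\ (H <| G)%g, (#|[~: H, H]%g| <= M)%N & few_exceptions G H].
Proof.
elim: k m => [|k IHk] m.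
  by exists 0%N => gT G H0 _; rewrite leqNgt indexg_gt0.
have /andP[eta_gt0 _] := eta_01 m.
have [T0 T0P] := exists_threshold eta_gt0.
(* [T0] serves the count of exceptions at tolerance [eta m]; [k.+1] bounds the index of [H0] and
   forces [H0] into [X]. *)
pose T := maxn T0 k.+1; have [M MP] := IHk (m * der_bound T)%N.
exists (maxn m M) => gT G H0 nsH0G leHk leHm.
have [|manyH0] := boolP (few_exceptions G H0).
  by exists H0; split=> //; rewrite leq_max leHm.
pose K := [~: H0, H0]%G; have nsKG : (K <| G)%g.
  exact: char_normal_trans (der_char 1 H0) nsH0G.
pose X := nearly_central_mod G K T.
have sH0G := normal_sub nsH0G.
have leGT : (#|G| <= T * #|H0|)%N.
  rewrite -(Lagrange sH0G) mulnC leq_mul2r (leq_trans leHk) ?orbT //.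
  exact: leq_maxr.
have sH0X : H0 \subset X.
  apply/subsetP=> x Hx; rewrite inE (subsetP sH0G) //= (leq_trans leGT) //.
  rewrite leq_mul2l subset_leq_card ?orbT //; apply/subsetP=> y Hy.
  by rewrite inE (subsetP sH0G) // mem_commg.
have nsXH0 : ~~ (X \subset H0).
  apply: contra manyH0 => /(card_exceptional_pairs nsH0G) leE.
  apply: le_trans (T0P _ #|G| _) _.
    by apply: leq_trans leE; rewrite leq_mul2r leq_maxl orbT.
  (* Since [#|[~: H0, H0]| <= m], the tolerance [eta m] is at most the one required for [H0]. *)
  by rewrite ler_wpM2r ?exprn_ge0 ?eta_decr.
have [|H1 [nsH1G sXH1 leH1]] := @normal_nearly_central_mod _ G K T nsKG.
  by rewrite (leq_trans leGT) // leq_mul2l subset_leq_card ?orbT.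
have [||H [nsHG leHM fewH]] := MP _ G H1 nsH1G; last 1 first.
- by exists H; split=> //; rewrite leq_max leHM orbT.
- have sH01 := subset_trans sH0X sXH1.
  rewrite -ltnS (leq_trans _ leHk) //.
  rewrite -(Lagrange_index (normal_sub nsH1G) sH01) ltn_Pmulr // indexg_gt1.
  by apply: contra nsXH0; apply: subset_trans.
by rewrite (leq_trans leH1) // leq_mul2r leHm orbT.
Qed.

End Main.

Theorem theorem2p6 (R : realType) (eta : nat -> R)
    (eta_decr : forall m n : nat, (m <= n)%N -> eta n <= eta m)
    (eta_01 : forall n : nat, 0 < eta n < 1) :
  exists M : nat, forall (gT : finGroupType) (G : {group gT}),
    exists H : {group gT},
      [/\ (H <| G)%g,
          (#|[~: H, H]%g| <= M)%N
        & #|exceptional_pairs G H|%:R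
            <= eta #|[~: H, H]%g| * #|G|%:R ^+ 2].
Proof.
(* The value at 1 is the tolerance for the trivial subgroup, whose derived subgroup has order 1. *)
have /andP[eta_gt0 _] := eta_01 1%N.
have [T TP] := exists_threshold eta_gt0.
have [M MP] := few_exceptions_bounded_index eta_decr eta_01 T (der_bound T).
exists (maxn 1 M) => gT G.
have [leG|ltG] := leqP #|G| (T * #|nearly_central_mod G 1%G T|).
  have [H1 [nsH1G sXH1]] := normal_nearly_central_mod (normal1 G) leG.
  rewrite cards1 mul1n => leH1.
  have [||H [nsHG leHM fewH]] := MP _ G H1 nsH1G => //; last first.
    by exists H; split=> //; rewrite leq_max leHM orbT.
  (* [H1] contains a set of density at least [1 / T], so its index is at most [T]. *)
  rewrite -(leq_pmul2l (cardG_gt0 H1)) Lagrange ?normal_sub //.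
  by rewrite mulnC (leq_trans leG) // leq_mul2l subset_leq_card ?orbT.
exists 1%G; rewrite normal1 commG1 cards1 leq_max; split=> //.
exact/TP/card_commuting_pairs.
Qed.
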